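(* Let $(X,g_X)$ and $(Y,g_Y)$ be weak Riemannian diffeological spaces, let $A$ be a diffeological space, and let $i\colon A\to X$ and $j\colon A\to Y$ be inductions such that $i^*g_X=j^*g_Y\colon T_2(A)\to\mathbb{R}$. Let $Z=X\coprod_A Y$ be the diffeological adjunction space (the pushout of $i$ and $j$, with the quotient diffeology), with natural maps $\rho_X\colon X\to Z$, $\rho_Y\colon Y\to Z$. Define $g\colon T_2(Z)\to\mathbb{R}$ as follows: for a plot $P\colon U_P\to Z$, $s\in U_P$ and $v_1,v_2\in T_sU_P$, choose an open neighborhood $W$ of $s$ in $U_P$ and either a plot $P_X\colon W\to X$ with $\rho_X\circ P_X=P|_W$, or a plot $P_Y\colon W\to Y$ with $\rho_Y\circ P_Y=P|_W$, and put $g([s,v_1,v_2]_P)=g_X([s,v_1,v_2]_{P_X})$ in the first case and $g([s,v_1,v_2]_P)=g_Y([s,v_1,v_2]_{P_Y})$ in the second. Then $g$ is a well-defined weak Riemannian metric on $Z$. Moreover, if $g_X$ and $g_Y$ are definite, then so is $g$.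
   Context: A domain is an open subset of some $\mathbb{R}^n$, $n\ge 0$. A diffeology $\mathcal{D}$ on a set $X$ is a set of maps $P\colon U_P\to X$ from domains (called plots) that contains all constant maps from domains, is closed under precomposition with smooth maps between domains, and is local (a map $U\to X$ from a domain whose restrictions to the members of some open cover of $U$ are plots is a plot). A map between diffeological spaces is smooth if its composite with every plot is a plot. An injective map $i\colon A\to X$ of diffeological spaces is an induction if the plots of $A$ are exactly the maps $P$ from domains to $A$ with $i\circ P$ a plot of $X$. The adjunction space $X\coprod_AY$ is the quotient set of $X\coprod Y$ by the equivalence relation generated by $i(a)\sim j(a)$, $a\in A$; its plots are the maps $P\colon U_P\to Z$ from domains such that each $s\in U_P$ has an open neighborhood on which $P$ is the composite of a plot of $X$ or a plot of $Y$ with the quotient map. Tangent construction: regard $\mathcal{D}$ as a category whose objects are plots and whose morphisms $P\to Q$ are smooth maps $h\colon U_P\to U_Q$ with $Q\circ h=P$. Put $T_2(X)=\operatorname{colim}_{P\in\mathcal{D}}\,(U_P\times\mathbb{R}^{\dim U_P}\times\mathbb{R}^{\dim U_P})$, where $h$ acts by $(r,v,w)\mapsto(h(r),Jh_r v,Jh_r w)$; $[r,v,w]_P$ denotes the class of $(r,v,w)$. A weak Riemannian metric on $X$ is a map $g\colon T_2(X)\to\mathbb{R}$ such that for every plot $P$ the map $g(P)_r(v,w):=g([r,v,w]_P)$ is a smooth symmetric covariant $2$-tensor on $U_P$ which is positive, i.e. $g(P)_r(v,v)\ge 0$. For a smooth map $\varphi\colon A\to X$, the pullback is $\varphi^*g=g\circ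 T_2(\varphi)$, i.e. $(\varphi^*g)(P)=g(\varphi\circ P)$. Generating family: a set $\mathcal{G}\subset\mathcal{D}$ such that a map $P\colon U_P\to X$ from a domain is in $\mathcal{D}$ iff every $r\in U_P$ has an open neighborhood $V$ in $U_P$ such that $P|_V$ is constant or $P|_V=Q\circ f$ for some $Q\in\mathcal{G}$ and smooth $f\colon V\to U_Q$. A weak Riemannian metric $g$ is definite if there is a generating family $\mathcal{G}$ such that $g(P)$ is a positive definite tensor on $U_P$ for every $P\in\mathcal{G}$. *)

(* Defs.v *)
From HB Require Import structures.
From mathcomp Require Import all_boot all_order all_algebra generic_quotient.
From mathcomp Require Import all_classical all_reals all_analysis.
From Stdlib Require Relation_Operators.
Import Order.TTheory GRing.Theory Num.Theory.
Import numFieldNormedType.Exports.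

Set Implicit Arguments.
Unset Strict Implicit.
Unset Printing Implicit Defensive.

Local Open Scope classical_set_scope.
Local Open Scope ring_scope.

Section quotient.
Context {T : Type} (e : T -> T -> Prop).

Definition gen_equiv : rel {classic T} :=
  fun x y => `[< Relation_Operators.clos_refl_sym_trans T e x y >].

Lemma gen_equiv_refl : reflexive gen_equiv.
Proof. by move=> x; apply/asboolP; exact: Relation_Operators.rst_refl. Qed.

Lemma gen_equiv_sym : symmetric gen_equiv.
Proof.
by move=> x y; apply/asboolP/asboolP; exact: Relation_Operators.rst_sym.
Qed.

Lemma gen_equiv_trans : transitive gen_equiv.
Proof.
move=> y x z /asboolP xy /asboolP yz; apply/asboolP.
exact: (Relation_Operators.rst_trans _ _ _ _ _ xy yz).
Qed.

Canonical gen_equiv_rel :=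
  EquivRel gen_equiv gen_equiv_refl gen_equiv_sym gen_equiv_trans.

Definition quot : Type := {eq_quot gen_equiv_rel}%qT.

Definition cls (x : T) : quot := (\pi_({eq_quot gen_equiv_rel}) x)%qT.

Definition rep (q : quot) : T := (repr (q : {eq_quot gen_equiv_rel}))%qT.

Lemma repK (q : quot) : cls (rep q) = q.
Proof. exact: reprK. Qed.

Lemma clsP (x y : T) :
  cls x = cls y <-> Relation_Operators.clos_refl_sym_trans T e x y.
Proof. by split => [/eqmodP/asboolP|xy]; [|apply/eqmodP/asboolP]. Qed.

End quotient.

Record domain (R : realType) (n : nat) := Domain {
  dom_set :> set 'rV[R]_n ;
  dom_open : open dom_set }.

Section smooth.
Context {R : realType}.

Fixpoint Ck {n} {V : normedModType R} (k : nat) (U : set 'rV[R]_n)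
    (f : 'rV[R]_n -> V) : Prop :=
  {in U, continuous f} /\
  if k is k'.+1 then
    forall i : 'I_n, {in U, forall x, derivable f x (delta_mx 0 i)} /\
      Ck k' U (fun x => 'D_(delta_mx 0 i) f x)
  else True.

(* [valL_ 0 f] extends [f] by 0 outside the open set [U], which affects
   neither continuity nor derivatives at the points of [U]. *)
Definition smooth_on {n} {U : domain R n} {V : normedModType R} (f : U -> V) :=
  forall k, Ck k U (valL_ 0 f).

Definition smooth_dom {m n} {U : domain R m} {V : domain R n} (h : U -> V) :=
  smooth_on (fun s => \val (h s)).

(* Tangent vectors are row vectors, on which the Jacobian acts on the right. *)
Definition tangent {m n} {U : domain R m} {V : domain R n} (h : U -> V)
    (r : U) (v : 'rV[R]_m) : 'rV[R]_n :=
  v *m 'J (valL_ 0 (fun s => \val (h s))) (\val r).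

Definition incl {n} {V U : domain R n} (VU : V `<=` U) (s : V) : U :=
  SigSub (mem_set (VU (\val s) (set_mem (valP s)))).

Lemma Ck_eq n (V : normedModType R) k (U W : set 'rV[R]_n)
    (f g : 'rV[R]_n -> V) :
  open W -> W `<=` U -> {in W, f =1 g} -> Ck k U f -> Ck k W g.
Proof.
move=> oW WU; elim: k f g => [|k IH] f g fg /= [cf df].
all: have nfg x : x \in W -> \near x, f x = g x.
1,3: move=> /set_mem Wx; apply: filterS (open_nbhs_nbhs (conj oW Wx)) => y Wy.
1,2: by apply: fg; exact: mem_set.
all: have cg : {in W, continuous g}.
1,3: move=> x xW; rewrite /continuous_at -(fg x xW).
1,2: apply: cvg_trans (cf x (mem_set (WU _ (set_mem xW)))).
1,2: exact: near_eq_cvg (nfg x xW).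
  by [].
split => // i; have [dif Cf] := df i; split.
  move=> x xW; apply: near_eq_derivable (nfg x xW) _.
  exact: dif (mem_set (WU _ (set_mem xW))).
by apply: IH Cf => x xW; exact: near_eq_derive (nfg x xW).
Qed.

Lemma valL_sub n (V : normedModType R) (U : domain R n) (f : U -> V) (s : U) :
  valL_ 0 f (\val s) = f s.
Proof. exact: (congr1 (@^~ s) (@valLK _ V 0 (dom_set U) f)). Qed.

Lemma preimage_open m n (U : domain R m) (V W : domain R n) (h : U -> V) :
  smooth_dom h ->
  open [set x | exists2 s : U, \val s = x & dom_set W (\val (h s))].
Proof.
move=> /(_ 0) /= [ch _]; rewrite openE => x [s <- Wh].
have Us : dom_set U (\val s) := set_mem (valP s).
have := ch _ (valP s) W.
rewrite valL_sub => /(_ (open_nbhs_nbhs (conj (@dom_open _ _ W) Wh))) nW.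
have nU : nbhs (\val s) (dom_set U) :=
  open_nbhs_nbhs (conj (@dom_open _ _ U) Us).
rewrite /interior; near=> y.
have Uy : dom_set U y by near: y; exact: nU.
exists (SigSub (mem_set Uy)) => //.
rewrite -(valL_sub (fun s => \val (h s)) (SigSub (mem_set Uy))) /=.
by near: y.
Unshelve. all: by end_near. Qed.

End smooth.

Record diffeologicalSpace (R : realType) := DiffeologicalSpace {
  ds_sort :> Type ;
  plot : forall n (U : domain R n), set (U -> ds_sort) ;
  plot_cst : forall n (U : domain R n) (x : ds_sort), plot (fun _ : U => x) ;
  plot_comp : forall m n (U : domain R m) (V : domain R n) (P : V -> ds_sort)
    (h : U -> V), plot P -> smooth_dom h -> plot (P \o h) ;
  plot_local : forall n (U : domain R n) (P : U -> ds_sort)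
    (C : set (domain R n)), \bigcup_(V in C) V = U ->
    (forall (V : domain R n) (VU : V `<=` U), C V -> plot (P \o incl VU)) ->
    plot P }.

Record plotOf (R : realType) (X : diffeologicalSpace R) := PlotOf {
  pdim : nat ;
  pdom : domain R pdim ;
  pmap :> pdom -> X ;
  pmapP : plot pmap }.

Section maps.
Context {R : realType}.
Implicit Types X Y A : diffeologicalSpace R.

Definition smooth {X Y} (f : X -> Y) :=
  forall n (U : domain R n) (P : U -> X), plot P -> plot (f \o P).

Definition is_induction {A X} (i : A -> X) :=
  injective i /\
  forall n (U : domain R n) (P : U -> A), plot P <-> plot (i \o P).

Lemma induction_smooth A X (i : A -> X) : is_induction i -> smooth i.
Proof. by move=> [_ iP] n U P /iP. Qed.

Definition plot_map {X Y} {f : X -> Y} (fs : smooth f) (P : plotOf X) :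
  plotOf Y := PlotOf (fs _ _ _ (pmapP P)).

End maps.

Section T2.
Context {R : realType}.
Implicit Types X Y : diffeologicalSpace R.

Record preT2 X := PreT2 {
  pt_plot : plotOf X ;
  pt_base : pdom pt_plot ;
  pt_fst : 'rV[R]_(pdim pt_plot) ;
  pt_snd : 'rV[R]_(pdim pt_plot) }.

Inductive T2_rel X : preT2 X -> preT2 X -> Prop :=
  T2Rel (P Q : plotOf X) (h : pdom P -> pdom Q) :
    smooth_dom h -> Q \o h = P ->
    forall r v w, T2_rel (@PreT2 X P r v w)
      (@PreT2 X Q (h r) (tangent h r v) (tangent h r w)).

Definition T2 X : Type := quot (@T2_rel X).

Definition T2_cls {X} (P : plotOf X) (r : pdom P) (v w : 'rV[R]_(pdim P)) :
  T2 X := cls (@T2_rel X) (PreT2 r v w).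

Definition preT2_map {X Y} {f : X -> Y} (fs : smooth f) (t : preT2 X) :
  preT2 Y := @PreT2 Y (plot_map fs (pt_plot t)) (pt_base t) (pt_fst t) (pt_snd t).

Definition T2_map {X Y} {f : X -> Y} (fs : smooth f) (q : T2 X) : T2 Y :=
  cls (@T2_rel Y) (preT2_map fs (rep q)).

Lemma T2_mapE X Y (f : X -> Y) (fs : smooth f) (P : plotOf X) r v w :
  T2_map fs (T2_cls (P := P) r v w) = T2_cls (P := plot_map fs P) r v w.
Proof.
rewrite /T2_map /T2_cls.
have /clsP : cls (@T2_rel X) (rep (cls (@T2_rel X) (PreT2 r v w))) =
  cls (@T2_rel X) (PreT2 r v w) by rewrite repK.
move: (rep _) => t; rewrite -[RHS]/(cls _ (preT2_map fs (PreT2 r v w))).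
elim=> {P r v w t} [_ _ [P Q h hs hQ r v w]|t|t u _ ->|t u z _ -> _ ->] //.
apply/clsP/Relation_Operators.rst_step.
apply: (@T2Rel Y (plot_map fs P) (plot_map fs Q) h hs).
by rewrite /= -hQ.
Qed.

(* Smoothness of a tensor is smoothness of its components; by bilinearity these
   may be taken along arbitrary constant vector fields. *)
Definition smooth_sym_tensor {n} {U : domain R n}
    (B : U -> 'rV[R]_n -> 'rV[R]_n -> R) :=
  [/\ forall r v, scalar (B r v),
      forall r w, scalar (B r ^~ w),
      forall r v w, B r v w = B r w v &
      forall v w, smooth_on (fun r => B r v w)].

Definition weak_riemannian {X} (g : T2 X -> R) :=
  forall P : plotOf X,
    smooth_sym_tensor (fun r v w => g (T2_cls (P := P) r v w)) /\
    forall r v, 0 <= g (T2_cls (P := P) r v v).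

Definition pullback {A X : diffeologicalSpace R} {f : A -> X} (fs : smooth f)
  (g : T2 X -> R) : T2 A -> R := g \o T2_map fs.

Definition generating {X} (G : set (plotOf X)) :=
  forall n (U : domain R n) (P : U -> X), plot P <->
    forall r : U, exists (V : domain R n) (VU : V `<=` U), dom_set V (\val r) /\
      ((exists x, forall s, P (incl VU s) = x) \/
       exists (Q : plotOf X) (f : V -> pdom Q),
         [/\ G Q, smooth_dom f & P \o incl VU = Q \o f]).

Definition definite {X} (g : T2 X -> R) :=
  exists2 G : set (plotOf X), generating G &
    forall P, G P -> forall r v, v != 0 -> 0 < g (T2_cls (P := P) r v v).

End T2.

Section adjunction.
Context {R : realType} {X Y A : diffeologicalSpace R} (i : A -> X) (j : A -> Y).

Inductive adj_rel : X + Y -> X + Y -> Prop :=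
  AdjRel (a : A) : adj_rel (inl (i a)) (inr (j a)).

Definition adj_inl (x : X) : quot adj_rel := cls adj_rel (inl x).
Definition adj_inr (y : Y) : quot adj_rel := cls adj_rel (inr y).

Definition adj_plot n (U : domain R n) (P : U -> quot adj_rel) :=
  forall s : U, exists (W : domain R n) (WU : W `<=` U), dom_set W (\val s) /\
    ((exists2 PX : W -> X, plot PX & P \o incl WU = adj_inl \o PX) \/
     (exists2 PY : W -> Y, plot PY & P \o incl WU = adj_inr \o PY)).

Lemma adj_plot_cst n (U : domain R n) (z : quot adj_rel) :
  adj_plot (fun _ : U => z).
Proof.
move=> s; exists U, (@subset_refl _ U); split; first exact: (set_mem (valP s)).
rewrite -(repK z); case: (rep z) => [x|y].
  by left; exists (cst x) => //; exact: plot_cst.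
by right; exists (cst y) => //; exact: plot_cst.
Qed.

Lemma adj_plot_comp m n (U : domain R m) (V : domain R n)
    (P : V -> quot adj_rel) (h : U -> V) :
  adj_plot P -> smooth_dom h -> adj_plot (P \o h).
Proof.
move=> aP hs s; have [W [WV [Wh PW]]] := aP (h s).
pose D := Domain (@preimage_open R m n U V W h hs).
have DU : D `<=` U by move=> x [t <- _]; exact: (set_mem (valP t)).
have hW (t : D) : dom_set W (\val (h (incl DU t))).
  have [u ut Wu] := set_mem (valP t).
  by have -> : incl DU t = u by apply: val_inj.
pose h' (t : D) : W := SigSub (mem_set (hW t)).
have h's : smooth_dom h'.
  move=> k; apply: (Ck_eq (@dom_open _ _ D) DU _ (hs k)) => x xD.
  pose t : D := SigSub xD.
  rewrite -[x]/(\val t) valL_sub -[\val t]/(\val (incl DU t)).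
  by rewrite (valL_sub (fun s => \val (h s)) (incl DU t)).
have hE : P \o h \o incl DU = (P \o incl WV) \o h'.
  by apply/funext => t /=; congr P; exact: val_inj.
exists D, DU; split; first by exists s.
case: PW => [[Q pQ PQ]|[Q pQ PQ]]; [left|right]; exists (Q \o h').
- exact: plot_comp.
- by rewrite hE PQ.
- exact: plot_comp.
- by rewrite hE PQ.
Qed.

Lemma adj_plot_local n (U : domain R n) (P : U -> quot adj_rel)
    (C : set (domain R n)) : \bigcup_(V in C) V = U ->
  (forall (V : domain R n) (VU : V `<=` U), C V -> adj_plot (P \o incl VU)) ->
  adj_plot P.
Proof.
move=> CU aP s; have : dom_set U (\val s) := set_mem (valP s).
rewrite -{1}CU => -[V CV Vs].
have VU : V `<=` U by rewrite -CU => x Vx; exists V.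
have [W [WV [Ws PW]]] := aP V VU CV (SigSub (mem_set Vs)).
have WU : W `<=` U := subset_trans WV VU.
exists W, WU; split => //.
have <- // : P \o incl VU \o incl WV = P \o incl WU.
by apply/funext => t /=; congr P; exact: val_inj.
Qed.

Definition adjunction : diffeologicalSpace R :=
  DiffeologicalSpace adj_plot_cst adj_plot_comp adj_plot_local.

Definition glued_value (gX : T2 X -> R) (gY : T2 Y -> R)
    (P : plotOf adjunction) (s : pdom P) (v1 v2 : 'rV[R]_(pdim P)) (c : R) :=
  exists (W : domain R (pdim P)) (WP : W `<=` pdom P) (t : W),
    incl WP t = s /\
    ((exists (PX : W -> X) (pPX : plot PX),
        adj_inl \o PX = P \o incl WP /\
        c = gX (T2_cls (P := PlotOf pPX) t v1 v2)) \/
     (exists (PY : W -> Y) (pPY : plot PY),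
        adj_inr \o PY = P \o incl WP /\
        c = gY (T2_cls (P := PlotOf pPY) t v1 v2))).

(* The equivalence says both that a local lift always exists and that every
   choice of lift, and of representative of the class, yields the same value. *)
Definition glued_metric (gX : T2 X -> R) (gY : T2 Y -> R)
    (g : T2 adjunction -> R) :=
  forall (P : plotOf adjunction) (s : pdom P) (v1 v2 : 'rV[R]_(pdim P)) (c : R),
    glued_value gX gY s v1 v2 c <-> g (T2_cls s v1 v2) = c.

End adjunction.

(* Main.v *)
(** Since [i] and [j] are injective, so are [rho_X] and [rho_Y], and a point of
    [X] is identified with a point of [Y] only if both come from one point of
    [A].  Hence two local lifts of a plot of [Z] either coincide, or one lies in
    [X] and the other in [Y] and both factor through a map to [A], which is a
    plot because [i] is an induction; there [i^* gX = j^* gY] says that the two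
    candidate values agree.  As lifts can be pulled back along smooth maps, the
    value depends only on the class in [T2 Z].  Both parts of the conclusion
    are then local, and hold because [g] is [gX] or [gY] along a lift. *)

Require Import Defs.
From mathcomp Require Import all_boot all_order all_algebra.
From mathcomp Require Import all_classical all_reals all_analysis.
From Stdlib Require Relation_Operators.
Set Implicit Arguments.
Unset Strict Implicit.
Import GRing.Theory Num.Theory.
Import numFieldNormedType.Exports Defs.
Local Open Scope classical_set_scope.
Local Open Scope ring_scope.

(** * Differentials and Jacobians as invariants of germs *)

(** ['d f a] is picked by [get] among the linear maps satisfying the first-order expansion, so it
    suffices that [f] and [g] give the same predicate; this also covers points where no such map
    exists. *)
Lemma near_eq_diff (K : numFieldType) (V W : normedModType K) (f g : V -> W)
    (a : V) : (\near a, f a = g a) -> 'd f a = 'd g a :> (V -> W).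
Proof.
move=> nfg; congr (fun df : {linear V -> W} => df : V -> W).
rewrite /diff; congr get; apply/funext => df; apply/propext.
have fga : f a = g a := nbhs_singleton nfg.
(* The epsilon form involves [u] only at [a] and near [a], hence transfers between [f] and [g]. *)
have expansionP (u : V -> W) :
    (forall x, u x = u (lim (nbhs a)) + df (x - lim (nbhs a))
       +o_(x \near a) (x - lim (nbhs a))) <->
    (forall e, 0 < e -> \forall x \near a,
       `|(u - (fun x => u a + df (x - a))) x| <= e * `|x - a|).
  rewrite lim_id //; split=> [uE|/eqaddoP uE x].
    apply/eqaddoP; rewrite funeqE => x; exact: uE.
  by rewrite {1}uE.
split=> -[cdf /expansionP dfE]; split => //; apply/expansionP => e e0.
all: move: (dfE e e0); apply: filterS2 nfg => x fgx; rewrite !fctE fgx.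
1,2: by rewrite fga.
Qed.

Lemma near_eq_jacobian (K : numFieldType) m n (f g : 'rV[K]_m -> 'rV[K]_n)
    (a : 'rV[K]_m) :
  (\forall x \near a, f x = g x) -> 'J f a = 'J g a.
Proof. by move=> /near_eq_diff /(congr1 (@lin1_mx _ _ _)). Qed.

Lemma jacobian_id (K : numFieldType) n (a : 'rV[K]_n) : 'J idfun a = 1%:M.
Proof.
have dE : 'd idfun a = idfun :> ('rV[K]_n -> 'rV[K]_n).
  by apply: diff_lin => x; exact: cvg_id.
by apply/row_matrixP => k; rewrite !rowE mul_rV_lin1 dE mulmx1.
Qed.

(** * Smoothness on domains: locality and restriction *)

Section calculus.
Context {R : realType}.

Lemma Ck_cst n (V : normedModType R) k (U : set 'rV[R]_n) (c : V) :
  Ck k U (cst c).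
Proof.
elim: k c => [|k IH] c /=; split=> //; try by move=> x _; exact: cst_continuous.
move=> i; split; first by move=> x _; exact: derivable_cst.
have -> : (fun x : 'rV[R]_n => 'D_(delta_mx 0 i) (cst c) x) = cst (0 : V).
  by apply/funext => x; rewrite derive_cst.
exact: IH.
Qed.

Lemma Ck_id n k (U : set 'rV[R]_n) : Ck k U (@idfun 'rV[R]_n).
Proof.
have cid : {in U, continuous (@idfun 'rV[R]_n)} by move=> x _; exact: cvg_id.
case: k => [//|k]; split => // i; split; first by move=> x _; exact: derivable_id.
have -> : (fun x => 'D_(delta_mx 0 i) (@idfun 'rV[R]_n) x) = cst (delta_mx 0 i).
  by apply/funext => x; rewrite derive_id.
exact: Ck_cst.
Qed.

(** Each clause of [Ck] is a condition at single points on a function defined on the whole space, so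
    the sets [W] can be arbitrary. *)
Lemma Ck_local n (V : normedModType R) k (U : set 'rV[R]_n)
    (f : 'rV[R]_n -> V) :
  (forall x, U x -> exists2 W : set 'rV[R]_n, W x & Ck k W f) -> Ck k U f.
Proof.
elim: k f => [|k IH] f loc /=.
all: split=> //.
1,2: move=> x /set_mem /loc [W Wx [cf _]]; exact: cf (mem_set Wx).
move=> i; split.
  by move=> x /set_mem /loc [W Wx [_ /(_ i) [df _]]]; exact: df (mem_set Wx).
by apply: IH => x /loc [W Wx [_ /(_ i) [_ Cf]]]; exists W.
Qed.

(** The two extensions by 0 can differ only outside the open set [W]. *)
Lemma near_valL_incl n (V : normedModType R) (W U : domain R n) (WU : W `<=` U)
    (f : U -> V) (t : W) :
  \forall x \near \val t, valL_ 0 (f \o incl WU) x = valL_ 0 f x.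
Proof.
have Wt : dom_set W (\val t) := set_mem (valP t).
apply: filterS (open_nbhs_nbhs (conj (@dom_open _ _ W) Wt)) => x Wx.
rewrite -[x]/(\val (SigSub (mem_set Wx) : W)) valL_sub.
exact: esym (valL_sub f (incl WU (SigSub (mem_set Wx)))).
Qed.

Lemma smooth_dom_incl n (W U : domain R n) (WU : W `<=` U) :
  smooth_dom (incl WU).
Proof.
move=> k; apply: (Ck_eq (@dom_open _ _ W) (@subset_refl _ W) _ (@Ck_id n k W)).
by move=> x xW; rewrite -[x in RHS]/(\val (SigSub xW : W)) valL_sub.
Qed.

Lemma smooth_on_local n (V : normedModType R) (U : domain R n) (f : U -> V) :
  (forall s : U, exists (W : domain R n) (WU : W `<=` U),
     dom_set W (\val s) /\ smooth_on (f \o incl WU)) -> smooth_on f.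
Proof.
move=> loc k; apply: Ck_local => x Ux.
have [W [WU [Wx /(_ k) sf]]] := loc (SigSub (mem_set Ux)).
exists W => //; apply: (Ck_eq (@dom_open _ _ W) (@subset_refl _ W) _ sf).
move=> y yW; exact: (nbhs_singleton (near_valL_incl WU f (SigSub yW))).
Qed.

Lemma tangent_incl n (W U : domain R n) (WU : W `<=` U) t v :
  tangent (incl WU) t v = v.
Proof.
rewrite /tangent (@near_eq_jacobian _ _ _ _ idfun) ?jacobian_id ?mulmx1//.
have Wt : dom_set W (\val t) := set_mem (valP t).
apply: filterS (open_nbhs_nbhs (conj (@dom_open _ _ W) Wt)) => x Wx.
by rewrite -[x in LHS]/(\val (SigSub (mem_set Wx) : W)) valL_sub.
Qed.

(** As maps into row vectors, [h'] is the restriction of [h] to [D], so their extensions have the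
    same germ at [x]. *)
Lemma tangent_restrict m n (D U : domain R m) (W V : domain R n)
    (DU : D `<=` U) (WV : W `<=` V) (h : U -> V) (h' : D -> W) :
  (forall x, incl WV (h' x) = h (incl DU x)) ->
  forall x v, tangent h' x v = tangent h (incl DU x) v.
Proof.
move=> hE x v; rewrite /tangent.
have -> : (fun s => \val (h' s)) = (fun s => \val (h s)) \o incl DU.
  by apply/funext => s /=; rewrite -hE.
have /near_eq_jacobian dE := near_valL_incl DU (fun s => \val (h s)) x.
have -> : \val (incl DU x) = \val x by [].
by rewrite -dE.
Qed.

(** [D] is the preimage of [W] under [h], and [h'] is [h] restricted at both ends: the square along
    which a lift over [W] is pulled back. *)
Lemma preimage_restrict m n (U : domain R m) (V W : domain R n)
    (WV : W `<=` V) (h : U -> V) (s : U) (t : W) :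
  smooth_dom h -> incl WV t = h s ->
  exists (D : domain R m) (DU : D `<=` U) (s' : D) (h' : D -> W),
    [/\ incl DU s' = s, h' s' = t, smooth_dom h' &
      forall x, incl WV (h' x) = h (incl DU x)].
Proof.
move=> hs ts; pose D := Domain (@preimage_open R m n U V W h hs).
have DU : D `<=` U by move=> x [u <- _]; exact: (set_mem (valP u)).
have Ds : dom_set D (\val s).
  by exists s => //; rewrite -ts; exact: (set_mem (valP t)).
have hW (x : D) : dom_set W (\val (h (incl DU x))).
  have [u ux Wu] := set_mem (valP x).
  by have -> : incl DU x = u by exact: val_inj.
pose h' (x : D) : W := SigSub (mem_set (hW x)).
have hE x : incl WV (h' x) = h (incl DU x) by exact: val_inj.
have sE : incl DU (SigSub (mem_set Ds)) = s by exact: val_inj.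
exists D, DU, (SigSub (mem_set Ds)), h'; split=> //.
  by apply: val_inj; rewrite -[LHS]/(\val (h (incl DU _))) sE -ts.
move=> k; apply: (Ck_eq (@dom_open _ _ D) DU _ (hs k)) => x xD.
have /= <- := nbhs_singleton (near_valL_incl DU (fun s => \val (h s)) (SigSub xD)).
by congr valL_.
Qed.

End calculus.

(** * Tangent classes under reparametrization *)

Section T2_classes.
Context {R : realType}.
Implicit Types X : diffeologicalSpace R.

Lemma T2_cls_comp X m n (U : domain R m) (V : domain R n) (P : V -> X)
    (pP : plot P) (h : U -> V) (pPh : plot (P \o h))
    (r : U) (v w : 'rV[R]_m) :
  smooth_dom h ->
  T2_cls (P := PlotOf pPh) r v w =
  T2_cls (P := PlotOf pP) (h r) (tangent h r v) (tangent h r w).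
Proof.
move=> hs; apply/clsP/Relation_Operators.rst_step.
exact: (@T2Rel _ _ (PlotOf pPh) (PlotOf pP)).
Qed.

Lemma T2_cls_incl X n (W U : domain R n) (WU : W `<=` U) (P : U -> X)
    (pP : plot P) (pPW : plot (P \o incl WU))
    (t : W) (v w : 'rV[R]_n) :
  T2_cls (P := PlotOf pPW) t v w = T2_cls (P := PlotOf pP) (incl WU t) v w.
Proof.
by rewrite (T2_cls_comp pP) ?tangent_incl//; exact: smooth_dom_incl.
Qed.

Lemma plot_incl X n (W U : domain R n) (WU : W `<=` U) (P : U -> X) :
  plot P -> plot (P \o incl WU).
Proof. by move=> pP; apply: plot_comp => //; exact: smooth_dom_incl. Qed.

End T2_classes.

(** * Values computed from local lifts *)

Section lifts.
Context {R : realType}.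
Implicit Types X Z : diffeologicalSpace R.

(** One branch of [glued_value], for an arbitrary map [rho], so that the cases of [X] and [Y] share
    their lemmas. *)
Definition lift_value {X} {Z : diffeologicalSpace R} (rho : X -> Z)
    (g : T2 X -> R) (P : plotOf Z) (s : pdom P) (v1 v2 : 'rV[R]_(pdim P))
    (c : R) :=
  exists (W : domain R (pdim P)) (WP : W `<=` pdom P) (t : W),
    incl WP t = s /\ exists (PX : W -> X) (pPX : plot PX),
      rho \o PX = P \o incl WP /\ c = g (T2_cls (P := PlotOf pPX) t v1 v2).

(** A lift [PX] of [Q] pulls back to the lift [PX \o h'] of [P], and [T2 X] identifies the
    corresponding classes along [h']. *)
Lemma lift_value_comp X Z (rho : X -> Z) (g : T2 X -> R) (P Q : plotOf Z)
    (h : pdom P -> pdom Q) r v w c : smooth_dom h -> Q \o h = P ->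
  lift_value rho g (h r) (tangent h r v) (tangent h r w) c ->
  lift_value rho g r v w c.
Proof.
move=> hs hQ [W [WQ [t [tr [PX [pPX [PXE ->]]]]]]].
have [D [DP [r' [h' [rE tE h's hE]]]]] := preimage_restrict hs tr.
exists D, DP, r'; split => //; exists (PX \o h'), (plot_comp pPX h's); split.
  by rewrite compA PXE -hQ; apply/funext => x /=; rewrite hE.
by rewrite (T2_cls_comp pPX _ _ _ _ h's) tE !(tangent_restrict hE) rE.
Qed.

(** Covers both ways of comparing two lifts: on one side, where injectivity makes them equal, and
    across the two sides, where they meet in [A]. *)
Definition metrics_agree {X X' : diffeologicalSpace R} {Z : Type}
    (rho : X -> Z) (rho' : X' -> Z) (g : T2 X -> R) (g' : T2 X' -> R) :=
  forall n (U : domain R n) (P : U -> X) (P' : U -> X') (pP : plot P)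
    (pP' : plot P'), rho \o P = rho' \o P' ->
    forall (r : U) (v w : 'rV[R]_n), g (T2_cls (P := PlotOf pP) r v w) =
                  g' (T2_cls (P := PlotOf pP') r v w).

Lemma metrics_agree_sym X X' Z (rho : X -> Z) (rho' : X' -> Z) g g' :
  metrics_agree rho rho' g g' -> metrics_agree rho' rho g' g.
Proof. by move=> agree n U P P' pP pP' E r v w; rewrite (agree _ _ _ _ pP' pP). Qed.

Lemma metrics_agree_inj X (Z : Type) (rho : X -> Z) (g : T2 X -> R) :
  injective rho -> metrics_agree rho rho g g.
Proof.
move=> rho_inj n U P P' pP pP' /funeqP E r v w.
have PE : P = P' by apply/funext => s; exact: rho_inj (E s).
(* The classes still carry two different proofs that the same map is a plot. *)
by move: pP pP'; rewrite PE => pP pP'; rewrite (Prop_irrelevance pP pP').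
Qed.

Lemma lift_value_uniq X X' Z (rho : X -> Z) (rho' : X' -> Z) g g' P s v w c c' :
  metrics_agree rho rho' g g' -> lift_value rho g (P := P) s v w c ->
  lift_value rho' g' s v w c' -> c = c'.
Proof.
move=> agree [W [WP [t [<- [Q [pQ [QE ->]]]]]]].
move=> [W' [WP' [t' [tt' [Q' [pQ' [QE' ->]]]]]]].
(* Both lifts are restricted to the intersection of their domains, where they lie over the same map;
   restriction leaves the classes unchanged. *)
have oD : open (dom_set W `&` dom_set W') by apply: openI; exact: dom_open.
pose D := Domain oD.
have DW : D `<=` W by move=> ? [].
have DW' : D `<=` W' by move=> ? [].
have Dt : dom_set D (\val t).
  split; first exact: (set_mem (valP t)).
  by rewrite -[\val t]/(\val (incl WP t)) -tt'; exact: (set_mem (valP t')).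
have tE : incl DW (SigSub (mem_set Dt)) = t by exact: val_inj.
have tE' : incl DW' (SigSub (mem_set Dt)) = t'.
  by apply: val_inj; rewrite -[RHS]/(\val (incl WP' t')) tt'.
rewrite -tE -tE' -(T2_cls_incl pQ (plot_incl DW pQ)).
rewrite -(T2_cls_incl pQ' (plot_incl DW' pQ')); apply: agree.
rewrite (compA rho) QE (compA rho') QE'; apply/funext => x /=; congr (P _); exact: val_inj.
Qed.

End lifts.

(** * Locality of the tensor conditions *)

Section tensors.
Context {R : realType}.

Lemma smooth_sym_tensor_local n (U : domain R n)
    (B : U -> 'rV[R]_n -> 'rV[R]_n -> R) :
  (forall s : U, exists (W : domain R n) (WU : W `<=` U),
     dom_set W (\val s) /\ smooth_sym_tensor (fun t => B (incl WU t))) ->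
  smooth_sym_tensor B.
Proof.
move=> loc.
(* Bilinearity and symmetry are conditions at one point, so it is enough to write [s] as an included
   point; only smoothness needs the whole neighborhood. *)
have at_point s : exists (W : domain R n) (WU : W `<=` U) (t : W),
    incl WU t = s /\ smooth_sym_tensor (fun t => B (incl WU t)).
  have [W [WU [Ws BW]]] := loc s.
  by exists W, WU, (SigSub (mem_set Ws)); split => //; exact: val_inj.
split.
- by move=> s v; have [W [WU [t [<- [+ _ _ _]]]]] := at_point s; exact.
- by move=> s w; have [W [WU [t [<- [_ + _ _]]]]] := at_point s; exact.
- by move=> s v w; have [W [WU [t [<- [_ _ + _]]]]] := at_point s; exact.
move=> v w; apply: smooth_on_local => s.
by have [W [WU [Ws [_ _ _ sB]]]] := loc s; exists W, WU; split => //; exact: sB.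
Qed.

End tensors.

(** * Points of the adjunction space *)

Section adjunction_points.
Context {R : realType} {X Y A : diffeologicalSpace R} {i : A -> X} {j : A -> Y}.
Hypotheses (i_inj : injective i) (j_inj : injective j).

(** A normal form realizing the pushout as the disjoint union of [X] and the complement of [j(A)] in
    [Y]. Being constant on classes, it separates points without analysing chains of the generated
    relation. *)
Definition adj_normal (u : X + Y) : X + Y :=
  if u is inr y then
    if pselect (exists a, j a = y) is left ya then inl (i (sval (cid ya)))
    else u
  else u.

Lemma adj_normalP u v :
  cls (adj_rel i j) u = cls (adj_rel i j) v -> adj_normal u = adj_normal v.
Proof.
move=> /clsP; elim=> {u v} [_ _ [a]|u|u v _ ->|u v w _ -> _ ->] //=.
case: pselect => [ya|[]]; last by exists a.
(* The preimage chosen by [cid] is [a] itself, as [j] is injective. *)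
by congr (inl (i _)); case: cid => b /= /j_inj.
Qed.

Lemma adj_inl_inj : injective (adj_inl i j).
Proof. by move=> x x' /adj_normalP []. Qed.

Lemma adj_inr_inj : injective (adj_inr i j).
Proof.
move=> y y' /adj_normalP /=.
(* If just one of [y], [y'] comes from [A], the normal forms lie in different summands; if both do,
   injectivity of [i] identifies the preimages. *)
case: pselect => [ya|_]; case: pselect => [ya'|_] //; last by case.
by case: cid => a aE; case: cid => a' aE' /= [] /i_inj aa'; rewrite -aE -aE' aa'.
Qed.

Lemma adj_inl_inr x y : adj_inl i j x = adj_inr i j y ->
  exists a, i a = x /\ j a = y.
Proof.
move=> /adj_normalP /=; case: pselect => // ya [->].
by exists (sval (cid ya)); split => //; exact: svalP (cid ya).
Qed.

End adjunction_points.

(** * The glued metric: existence and uniqueness *)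

Section gluing.
Context {R : realType} {X Y A : diffeologicalSpace R}.
Context {gX : T2 X -> R} {gY : T2 Y -> R} {i : A -> X} {j : A -> Y}.
Context (hi : is_induction i) (hj : is_induction j).
Context (hij : pullback (induction_smooth hi) gX =
               pullback (induction_smooth hj) gY).

Local Notation Z := (adjunction i j).
Local Notation rhoX := (adj_inl i j : X -> Z).
Local Notation rhoY := (adj_inr i j : Y -> Z).

Lemma metrics_agree_adj : metrics_agree rhoX rhoY gX gY.
Proof.
move=> n U P P' pP pP' /funeqP E r v w.
(* [Q] is chosen pointwise; it becomes a plot only through [i \o Q = P]. *)
have /choice [Q QE] : forall s, exists a, i a = P s /\ j a = P' s.
  by move=> s; apply: (adj_inl_inr hj.1) (E s).
have PE : P = i \o Q by apply/funext => s /=; rewrite (QE s).1.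
have PE' : P' = j \o Q by apply/funext => s /=; rewrite (QE s).2.
move: pP pP'; rewrite PE PE' => pP pP'.
have pQ : plot Q by apply/(hi.2 _ _ _).
have := congr1 (@^~ (T2_cls (P := PlotOf pQ) r v w)) hij.
rewrite /pullback /= !T2_mapE /plot_map /=.
rewrite (Prop_irrelevance pP (induction_smooth hi pQ)).
by rewrite (Prop_irrelevance pP' (induction_smooth hj pQ)).
Qed.

Lemma glued_valueE (P : plotOf Z) s v w c : glued_value gX gY (P := P) s v w c <->
  lift_value rhoX gX s v w c \/ lift_value rhoY gY s v w c.
Proof.
split.
- by move=> [W [WP [t [ts [L|L]]]]]; [left|right]; exists W, WP, t.
- move=> [|] [W [WP [t [ts L]]]]; exists W, WP, t; split => //.
  + by left.
  + by right.
Qed.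

Lemma glued_value_exists (P : plotOf Z) s v w :
  exists c, glued_value gX gY (P := P) s v w c.
Proof.
have [W [WP [Ws PW]]] := pmapP P s.
pose t : W := SigSub (mem_set Ws).
have ts : incl WP t = s by exact: val_inj.
case: PW => -[Q pQ PQ].
- exists (gX (T2_cls (P := PlotOf pQ) t v w)); exists W, WP, t.
  by split => //; left; exists Q, pQ.
- exists (gY (T2_cls (P := PlotOf pQ) t v w)); exists W, WP, t.
  by split => //; right; exists Q, pQ.
Qed.

Lemma glued_value_uniq (P : plotOf Z) s v w c c' :
  glued_value gX gY (P := P) s v w c -> glued_value gX gY s v w c' -> c = c'.
Proof.
have XX : metrics_agree rhoX rhoX gX gX :=
  metrics_agree_inj gX (adj_inl_inj (i := i) hj.1).
have YY : metrics_agree rhoY rhoY gY gY :=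
  metrics_agree_inj gY (adj_inr_inj hi.1 hj.1).
have XY := metrics_agree_adj; have YX := metrics_agree_sym XY.
move=> /glued_valueE [] L /glued_valueE [] L'.
- exact: (lift_value_uniq XX L L').
- exact: (lift_value_uniq XY L L').
- exact: (lift_value_uniq YX L L').
- exact: (lift_value_uniq YY L L').
Qed.

(** Stated as an equivalence, so that in the induction on the generated relation only the generating
    step needs an argument. *)
Lemma glued_value_cls (t u : preT2 Z) c : cls (@T2_rel R Z) t = cls (@T2_rel R Z) u ->
  glued_value gX gY (pt_base t) (pt_fst t) (pt_snd t) c <->
  glued_value gX gY (pt_base u) (pt_fst u) (pt_snd u) c.
Proof.
move=> /clsP; elim=> {t u} [_ _ [P Q h hs hQ r v w]|t|t u _ ->|t u z _ -> _ ->] //=.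
have pull c' : glued_value gX gY (h r) (tangent h r v) (tangent h r w) c' ->
    glued_value gX gY r v w c'.
  move=> /glued_valueE [] L; apply/glued_valueE; [left|right];
  exact: lift_value_comp L.
split; last exact: pull.
(* A lift of [P] need not descend along [h]. Instead some value [c'] exists at [Q]; it pulls back to
   [P], and uniqueness there gives [c = c']. *)
move=> Pc; have [c' Qc] := glued_value_exists (h r) (tangent h r v) (tangent h r w).
by rewrite (glued_value_uniq Pc (pull _ Qc)).
Qed.

Lemma glued_metric_exists_uniq :
  exists! g : T2 Z -> R, glued_metric gX gY g.
Proof.
have /choice [g gP] : forall q : T2 Z, exists c,
    glued_value gX gY (pt_base (rep q)) (pt_fst (rep q)) (pt_snd (rep q)) c.
  by move=> q; exact: glued_value_exists.
(* [g] was chosen at the representatives [rep q]; class invariance carries it to every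
   representative. *)
have gE P s v w : glued_value gX gY (P := P) s v w (g (T2_cls s v w)).
  by apply/(glued_value_cls _ (repK (T2_cls s v w))).
exists g; split.
  move=> P s v w c; split=> [|<-]; last exact: gE.
  exact: glued_value_uniq (gE _ _ _ _).
move=> g' g'P; apply/funext => q; rewrite -(repK q).
by case: (rep q) => P s v w; apply/esym/g'P; exact: gE.
Qed.

(** * The glued metric is weak Riemannian *)

Context {g : T2 Z -> R} (hg : glued_metric gX gY g).

Lemma glued_metric_inl (P : plotOf Z) (W : domain R (pdim P)) (WP : W `<=` pdom P)
    (Q : W -> X) (pQ : plot Q) : P \o incl WP = rhoX \o Q -> forall t v w,
  g (T2_cls (incl WP t) v w) = gX (T2_cls (P := PlotOf pQ) t v w).
Proof.
move=> PQ t v w; apply/hg; exists W, WP, t; split => //.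
by left; exists Q, pQ.
Qed.

Lemma glued_metric_inr (P : plotOf Z) (W : domain R (pdim P)) (WP : W `<=` pdom P)
    (Q : W -> Y) (pQ : plot Q) : P \o incl WP = rhoY \o Q -> forall t v w,
  g (T2_cls (incl WP t) v w) = gY (T2_cls (P := PlotOf pQ) t v w).
Proof.
move=> PQ t v w; apply/hg; exists W, WP, t; split => //.
by right; exists Q, pQ.
Qed.

Lemma glued_metric_weak_riemannian :
  weak_riemannian gX -> weak_riemannian gY -> weak_riemannian g.
Proof.
move=> hX hY P.
have loc (s : pdom P) : exists (W : domain R (pdim P)) (WP : W `<=` pdom P),
    [/\ dom_set W (\val s),
        smooth_sym_tensor (fun t v w => g (T2_cls (incl WP t) v w)) &
        forall t v, 0 <= g (T2_cls (incl WP t) v v)].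
  have [W [WP [Ws [[Q pQ PQ]|[Q pQ PQ]]]]] := pmapP P s; exists W, WP.
  - have [tQ posQ] := hX (PlotOf pQ).
    split=> // [|t v]; last by rewrite (glued_metric_inl pQ PQ).
    rewrite (_ : (fun t v w => _) =
      (fun t v w => gX (T2_cls (P := PlotOf pQ) t v w))) //.
    by apply/funext => t; apply/funext => v; apply/funext => w; exact: glued_metric_inl.
  - have [tQ posQ] := hY (PlotOf pQ).
    split=> // [|t v]; last by rewrite (glued_metric_inr pQ PQ).
    rewrite (_ : (fun t v w => _) =
      (fun t v w => gY (T2_cls (P := PlotOf pQ) t v w))) //.
    by apply/funext => t; apply/funext => v; apply/funext => w; exact: glued_metric_inr.
split.
  by apply: smooth_sym_tensor_local => s; have [W [WP [Ws tW _]]] := loc s; exists W, WP.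
move=> s v; have [W [WP [Ws _ posW]]] := loc s.
have <- : incl WP (SigSub (mem_set Ws)) = s by exact: val_inj.
exact: posW.
Qed.

Lemma adj_inl_smooth : smooth rhoX.
Proof.
move=> n U P pP s; exists U, (@subset_refl _ U); split; first exact: (set_mem (valP s)).
by left; exists (P \o incl (@subset_refl _ U)) => //; exact: plot_incl.
Qed.

Lemma adj_inr_smooth : smooth rhoY.
Proof.
move=> n U P pP s; exists U, (@subset_refl _ U); split; first exact: (set_mem (valP s)).
by right; exists (P \o incl (@subset_refl _ U)) => //; exact: plot_incl.
Qed.

Lemma glued_metric_plot_inl (Q : plotOf X) r v w :
  g (T2_cls (P := plot_map adj_inl_smooth Q) r v w) = gX (T2_cls (P := Q) r v w).
Proof.
case: Q r v w => n U Q pQ r v w.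
(* The lift is global, with [W = U], but [incl] rebuilds the membership proof and is the identity
   only up to [val_inj]. *)
have inclK (t : U) : incl (@subset_refl _ U) t = t by exact: val_inj.
apply/hg; exists U, (@subset_refl _ U), r; split; first exact: inclK.
left; exists Q, pQ; split => //.
by apply/funext => t /=; rewrite inclK.
Qed.

Lemma glued_metric_plot_inr (Q : plotOf Y) r v w :
  g (T2_cls (P := plot_map adj_inr_smooth Q) r v w) = gY (T2_cls (P := Q) r v w).
Proof.
case: Q r v w => n U Q pQ r v w.
have inclK (t : U) : incl (@subset_refl _ U) t = t by exact: val_inj.
apply/hg; exists U, (@subset_refl _ U), r; split; first exact: inclK.
right; exists Q, pQ; split => //.
by apply/funext => t /=; rewrite inclK.
Qed.

(** * Generating families and definiteness *)

Definition adj_family (GX : set (plotOf X)) (GY : set (plotOf Y)) :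
    set (plotOf Z) :=
  plot_map adj_inl_smooth @` GX `|` plot_map adj_inr_smooth @` GY.

(** Two successive shrinkings: a plot of [Z] lifts over [W] to [X] or [Y], and the lift is constant
    or factors through a generator over a smaller [V]. *)
Lemma generating_adj GX GY :
  generating GX -> generating GY -> generating (adj_family GX GY).
Proof.
move=> genX genY n U P; split=> [pP r|loc r].
- have [W [WU [Wr PW]]] := pP r.
  pose t : W := SigSub (mem_set Wr).
  case: PW => -[Q pQ PQ].
  + have [V [VW [Vt QV]]] := (genX _ _ _).1 pQ t.
    have VU := subset_trans VW WU.
    have PV : P \o incl VU = rhoX \o (Q \o incl VW).
      rewrite compA -PQ; apply/funext => s /=; congr P; exact: val_inj.
    exists V, VU; split => //; case: QV => [[x Qx]|[Q' [f [GQ' fs QE]]]].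
    * by left; exists (rhoX x) => s; rewrite -[LHS]/((P \o incl VU) s) PV /= Qx.
    * right; exists (plot_map adj_inl_smooth Q'), f; split => //.
        by left; exists Q'.
      by rewrite PV QE.
  + have [V [VW [Vt QV]]] := (genY _ _ _).1 pQ t.
    have VU := subset_trans VW WU.
    have PV : P \o incl VU = rhoY \o (Q \o incl VW).
      rewrite compA -PQ; apply/funext => s /=; congr P; exact: val_inj.
    exists V, VU; split => //; case: QV => [[x Qx]|[Q' [f [GQ' fs QE]]]].
    * by left; exists (rhoY x) => s; rewrite -[LHS]/((P \o incl VU) s) PV /= Qx.
    * right; exists (plot_map adj_inr_smooth Q'), f; split => //.
        by right; exists Q'.
      by rewrite PV QE.
- have [V [VU [Vr PV]]] := loc r.
  (* Generators are plots of [Z], so [P] is a plot over [V] and lifts near [r]; this lift is the one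
     required for [P]. *)
  have pPV : plot (P \o incl VU : V -> Z).
    case: PV => [[x Px]|[Q [f [_ fs ->]]]]; last exact: plot_comp (pmapP Q) fs.
    by rewrite (_ : _ \o _ = fun=> x); [exact: plot_cst|exact/funext].
  have [W [WV [Wr PW]]] := pPV (SigSub (mem_set Vr)).
  exists W, (subset_trans WV VU); split => //.
  rewrite (_ : P \o _ = P \o incl VU \o incl WV) //.
  by apply/funext => s /=; congr P; exact: val_inj.
Qed.

(** Composing a generator with [rhoX] or [rhoY] keeps its domain and tangent vectors, and there [g]
    equals [gX] or [gY], so positivity carries over. *)
Lemma glued_metric_definite : definite gX -> definite gY -> definite g.
Proof.
move=> [GX genX posX] [GY genY posY].
exists (adj_family GX GY); first exact: generating_adj.
by move=> _ [] [Q GQ <-] r v v0;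
  [rewrite glued_metric_plot_inl; exact: posX|
   rewrite glued_metric_plot_inr; exact: posY].
Qed.

End gluing.

Theorem theorem4p2 (R : realType) (X Y A : diffeologicalSpace R)
    (gX : T2 X -> R) (gY : T2 Y -> R)
    (hgX : weak_riemannian gX) (hgY : weak_riemannian gY)
    (i : A -> X) (j : A -> Y) (hi : is_induction i) (hj : is_induction j)
    (hij : pullback (induction_smooth hi) gX = pullback (induction_smooth hj) gY) :
  (exists! g : T2 (adjunction i j) -> R, glued_metric gX gY g) /\
  (forall g : T2 (adjunction i j) -> R, glued_metric gX gY g ->
     weak_riemannian g /\ (definite gX -> definite gY -> definite g)).
Proof.
split; first exact: glued_metric_exists_uniq hij.
move=> g hg; split; first exact: glued_metric_weak_riemannian hg hgX hgY.
exact: glued_metric_definite hg.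
Qed.
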